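(* For every $n\ge 1$, the set $\{\pi\in\mathfrak{S}_n : \mathcal{T}^2(\pi)=\mathrm{id}\}$ equals $\mathfrak{S}_n(2431,\,241\overline{5}3)$, the set of permutations in $\mathfrak{S}_n$ that avoid both the pattern $2431$ and the barred pattern $241\overline{5}3$.
   Context: $\mathfrak{S}_n$ is the set of permutations of $\{1,\ldots,n\}$, written as words; $\mathrm{id}=12\cdots n$. The operator $\mathcal{T}$ (revstack sort) is defined recursively on finite words of distinct positive integers by $\mathcal{T}(\epsilon)=\epsilon$ for the empty word $\epsilon$, $\mathcal{T}(x)=x$ for a word $x$ of length 1, and $\mathcal{T}(LmR)=\mathcal{T}(R)\,\mathcal{T}(L)\,m$, where $m$ is the largest entry of $LmR$; $\mathcal{T}^2=\mathcal{T}\circ\mathcal{T}$. Classical pattern containment and avoidance are as usual. A permutation avoids the barred pattern $241\overline{5}3$ if every occurrence of the pattern $2413$ in it is part of an occurrence of $24153$; i.e. whenever $(b,d,a,c)$ is a subsequence (left to right) with $a<b<c<d$, there is an entry $e>d$ located between $a$ and $c$. *)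

(* Defs.v *)
From mathcomp Require Import all_boot all_fingroup.

Set Implicit Arguments.
Unset Strict Implicit.
Unset Printing Implicit Defensive.

Definition max_entry (w : seq nat) : nat := \max_(x <- w) x.

(* The fuel [k] only serves termination: [size w] always suffices, and
   [revstack_nil], [revstack_cat] are the intended recursive equations. *)
Fixpoint revstack_rec (k : nat) (w : seq nat) : seq nat :=
  match k, w with
  | k'.+1, _ :: _ =>
      let m := max_entry w in
      let i := index m w in
      revstack_rec k' (drop i.+1 w) ++ revstack_rec k' (take i w) ++ [:: m]
  | _, _ => [::]
  end.

Definition revstack (w : seq nat) : seq nat := revstack_rec (size w) w.

Lemma max_entry_in (w : seq nat) : w != [::] -> max_entry w \in w.
Proof.
rewrite /max_entry; elim: w => // x [|y w] IHw _; first by rewrite big_seq1 inE.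
rewrite big_cons inE; have {IHw} := IHw isT.
by case: leqP => _ => [-> | _]; rewrite ?eqxx ?orbT.
Qed.

Lemma revstack_rec_fuel (k : nat) (w : seq nat) :
  size w <= k -> revstack_rec k w = revstack w.
Proof.
rewrite /revstack; have [n] := ubnP (size w).
elim: n k w => // n IHn [|k] [|x w] // ltwn lewk.
rewrite [size (x :: w)]/= /revstack_rec -/revstack_rec.
set m := max_entry _; set i := index _ _.
have lti : i < size (x :: w) by rewrite index_mem max_entry_in.
have szd : size (drop i.+1 (x :: w)) <= size w.
  by rewrite size_drop /= subSS leq_subr.
have szt : size (take i (x :: w)) <= size w by rewrite size_take lti -ltnS.
have eqfuel v : size v <= size w -> revstack_rec k v = revstack_rec (size w) v.
  move=> lev; have ltvn : size v < n by apply: leq_ltn_trans lev _.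
  by rewrite !IHn // (leq_trans lev).
by rewrite !eqfuel.
Qed.

Lemma revstack_nil : revstack [::] = [::].
Proof. by []. Qed.

Lemma revstack_cat (L R : seq nat) (m : nat) :
  all (fun x => x < m) (L ++ R) ->
  revstack (L ++ m :: R) = revstack R ++ revstack L ++ [:: m].
Proof.
rewrite all_cat => /andP[/allP ltL /allP ltR].
have mE : max_entry (L ++ m :: R) = m.
  rewrite /max_entry big_cat big_cons /= maxnCA; apply/maxn_idPl.
  by rewrite geq_max; apply/andP; split; apply/bigmax_leqP_seq => x xin _;
     apply: ltnW; [apply: ltL | apply: ltR].
have iE : index m (L ++ m :: R) = size L.
  rewrite index_cat /= eqxx addn0; case: ifP => // /ltL.
  by rewrite ltnn.
rewrite {1}/revstack size_cat /= addnS.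
have [x [s wE]] : exists x s, L ++ m :: R = x :: s.
  by case: (L) => [|y L']; [exists m, R | exists y, (L' ++ m :: R)].
rewrite /= wE -{}wE mE iE take_size_cat // -cat_rcons drop_size_cat ?size_rcons //.
by rewrite !revstack_rec_fuel // ?leq_addl ?leq_addr.
Qed.

Lemma revstack_seq1 (x : nat) : revstack [:: x] = [:: x].
Proof. exact: (@revstack_cat [::] [::]). Qed.

Definition perm_word (n : nat) (p : {perm 'I_n}) : seq nat :=
  [seq (p i : nat).+1 | i <- enum 'I_n].

Definition order_iso (s t : seq nat) : bool :=
  (size s == size t) &&
  [forall i : 'I_(size s), forall j : 'I_(size s),
    (nth 0 s i < nth 0 s j) == (nth 0 t i < nth 0 t j)].

Definition subwords (w : seq nat) : seq (seq nat) :=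
  [seq mask (m : (size w).-tuple bool) w | m : (size w).-tuple bool].

Lemma mem_subwords (s w : seq nat) : (s \in subwords w) = subseq s w.
Proof.
apply/mapP/subseqP => [[m _ ->] | [m /eqP szm ->]].
  by exists m; rewrite ?size_tuple.
by exists (Tuple szm); rewrite ?mem_enum.
Qed.

(* In a word with distinct entries a subword determines its positions, so the
   subwords order-isomorphic to [tau] are exactly the occurrences of [tau]. *)
Definition occurrences (tau w : seq nat) : seq (seq nat) :=
  [seq s <- subwords w | order_iso s tau].

Definition contains (tau w : seq nat) : bool := occurrences tau w != [::].

Definition avoids (tau w : seq nat) : bool := ~~ contains tau w.

(* [tau'] is the barred pattern with its bar removed, and [tau] the
   standardization of what is left once its barred letter is deleted.  In general "part of an occurrence" must
   place [tau] on the unbarred letters of [tau'], which [subseq] does not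
   record; for 24153 it is automatic, since 5 is the only letter whose deletion
   leaves a word order-isomorphic to 2413. *)
Definition avoids_barred (tau tau' w : seq nat) : bool :=
  all (fun s => has (subseq s) (occurrences tau' w)) (occurrences tau w).

Definition avoids_241b53 (w : seq nat) : bool :=
  avoids_barred [:: 2; 4; 1; 3] [:: 2; 4; 1; 5; 3] w.

(* Main.v *)
Require Import Defs.
From mathcomp Require Import all_boot all_fingroup.
From mathcomp Require Import zify.

(** Sorting sends L m R to T(R) T(L) m, where m is the largest letter.  Follow
    two letters a < b until a largest letter separates them.  If some letter
    above b lies between them, the separating letter is such a letter, and the
    two sides are exchanged; otherwise the separating letter is b itself, and b
    goes behind a.  Hence b precedes a in T(w) exactly when a, c, b occur in
    this order in w for some c > b: the inversions of T(w) are the 132 patterns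
    of w ([revstack_inversion]).

    Consequently T(T(w)) is increasing exactly when T(w) avoids 132.  A 132
    pattern a c b of T(w) consists of an inversion c b and a non-inversion a c,
    and each of these is again a condition on w ([revstack_132]).  Comparing the
    possible places of a with the subword b d c that witnesses the inversion
    leaves 2431 and those 2413 patterns b d a c that have no letter above c
    between a and c.  Raising c to the largest letter below d between a and c
    shows that the latter exist as soon as some 2413 pattern has no letter above
    d between a and c, that is, as soon as the barred pattern is not avoided
    ([revstack2_sorted], [avoids_241b53P]). *)

Set Implicit Arguments.
Unset Strict Implicit.
Unset Printing Implicit Defensive.

(** * Positions in a word without repetitions *)

Definition before (w : seq nat) : rel nat :=
  fun x y => index x w < index y w.

Lemma before_trans w : transitive (before w).
Proof. by move=> y x z; apply: ltn_trans. Qed.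

Lemma uniq_sorted_before w : uniq w -> sorted (before w) w.
Proof.
move=> Uw; rewrite sorted_pairwise; last exact: before_trans.
by apply/(pairwiseP 0) => i j ltiw ltjw ltij; rewrite /before !index_uniq.
Qed.

(** A word without repetitions is sorted by its own position order, so a
    subword is the same thing as a word over its letters listed in that order:
    both this word and the subword of [w] with the same letters are sorted. *)
Lemma subseq_before s w :
  uniq w -> subseq s w = all (mem w) s && sorted (before w) s.
Proof.
move=> Uw; have sw := uniq_sorted_before Uw.
apply/idP/andP => [sub_sw | [/allP s_w sort_s]].
  split; first by apply/allP => x /(mem_subseq sub_sw).
  exact: subseq_sorted (@before_trans w) _ _ sub_sw sw.
suff -> : s = [seq x <- w | x \in s] by apply: filter_subseq.
apply: (irr_sorted_eq (@before_trans w)) => //.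
- by move=> x; rewrite /before ltnn.
- exact: sorted_filter (@before_trans w) _ _ sw.
by move=> x; rewrite mem_filter; case: (boolP (x \in s)) => //= /s_w/= ->.
Qed.

Lemma index_catl x (s t : seq nat) : x \in s -> index x (s ++ t) = index x s.
Proof. by rewrite index_cat => ->. Qed.

Lemma index_catr x (s t : seq nat) :
  x \notin s -> index x (s ++ t) = size s + index x t.
Proof. by rewrite index_cat => /negPf->. Qed.

(** * Revstack sort and its inversions *)

(** Induction along the recursion of revstack sort: a nonempty word is cut at
    its largest letter. *)
Lemma revstack_ind (P : seq nat -> Prop) :
  P [::] ->
  (forall L m R, uniq (L ++ m :: R) -> all (fun x => x < m) (L ++ R) ->
     P L -> P R -> P (L ++ m :: R)) ->
  forall w, uniq w -> P w.
Proof.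
move=> P0 Pcat w; have [k] := ubnP (size w).
elim: k w => // k IHk w ltwk Uw; have [-> // | w_n0] := eqVneq w [::].
have split x : x \in w -> exists L R : seq nat, w = L ++ x :: R.
  by case/splitPr=> L R; exists L, R.
have [L [R wE]] := split _ (max_entry_in w_n0) => {split}.
have le_max x : x \in w -> x <= max_entry w.
  by move=> xw; apply: (@leq_bigmax_seq _ w xpredT id).
move: (max_entry w) wE le_max => m wE; rewrite {}wE in ltwk Uw * => le_m.
move: (Uw); rewrite cat_uniq /= negb_or => /and3P[UL /andP[mL _] /andP[mR UR]].
rewrite size_cat /= addnS ltnS in ltwk.
apply: Pcat => //; [|apply: IHk => //; apply: leq_ltn_trans ltwk..];
  rewrite ?leq_addr ?leq_addl //.
apply/allP => x; rewrite mem_cat => xLR; rewrite ltn_neqAle le_m; last first.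
  by rewrite mem_cat inE; case/orP: xLR => ->; rewrite ?orbT.
rewrite andbT; apply: contraTneq xLR => ->.
by rewrite negb_or mL.
Qed.

Lemma perm_revstack w : uniq w -> perm_eq (revstack w) w.
Proof.
move: w; apply: revstack_ind => // L m R _ ltm IHL IHR.
rewrite revstack_cat // perm_catC -catA perm_cat //=.
by rewrite perm_cons.
Qed.

Lemma revstack_uniq w : uniq w -> uniq (revstack w).
Proof. by move=> Uw; rewrite (perm_uniq (perm_revstack Uw)). Qed.

Lemma mem_revstack w : uniq w -> revstack w =i w.
Proof. by move=> Uw; apply: perm_mem (perm_revstack Uw). Qed.

(** With w = L m R and T(w) = T(R) T(L) m, letters on the same side of m are
    handled by induction, because every letter between them is on that side as
    well; if a is in L and b in R then m is the required c; if a is in R and b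
    in L both sides fail, and so they do if b = m. *)
Lemma revstack_inversion w a b :
  uniq w -> a \in w -> b \in w -> a < b ->
  subseq [:: b; a] (revstack w) <->
  exists2 c, b < c & subseq [:: a; c; b] w.
Proof.
move=> Uw aw bw ltab; rewrite subseq_before ?revstack_uniq //=.
rewrite !mem_revstack // aw bw /= andbT.
suff: before (revstack w) b a <->
      exists c, [/\ c \in w, b < c, before w a c & before w c b].
  move=> ->; split=> [[c [cw ltbc ac cb]] | [c ltbc]].
    by exists c => //; rewrite subseq_before //= aw bw cw ac cb.
  rewrite subseq_before //= andbT => /andP[/and3P[_ cw _] /andP[ac /andP[cb _]]].
  by exists c.
move: w Uw aw bw; apply: revstack_ind => // L m R Uw ltm IHL IHR.
move: (Uw); rewrite cat_uniq /= negb_or.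
move=> /and3P[UL /andP[mL /hasPn/= LR] /andP[mR UR]].
have ltLm x : x \in L -> x < m.
  by move=> xL; apply: (allP ltm); rewrite mem_cat xL.
have ltRm x : x \in R -> x < m.
  by move=> xR; apply: (allP ltm); rewrite mem_cat xR orbT.
have RL x : x \in L -> x \notin R by apply: contraTN => /LR.
have iL x : x \in L -> index x (L ++ m :: R) = index x L by apply: index_catl.
have im : index m (L ++ m :: R) = size L by rewrite index_catr //= eqxx addn0.
have iR x : x \in R -> index x (L ++ m :: R) = (size L + index x R).+1.
  move=> xR; rewrite index_catr ?LR //= ifN ?addnS //.
  by rewrite neq_ltn ltRm ?orbT.
have jR x : x \in R ->
    index x (revstack (L ++ m :: R)) = index x (revstack R).
  by move=> xR; rewrite revstack_cat // index_catl ?mem_revstack.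
have jL x : x \in L ->
    index x (revstack (L ++ m :: R)) = size R + index x (revstack L).
  move=> xL; rewrite revstack_cat // index_catr ?mem_revstack ?RL //.
  by rewrite index_catl ?mem_revstack // (perm_size (perm_revstack UR)).
have jm : index m (revstack (L ++ m :: R)) = size R + size L.
  rewrite revstack_cat // !index_catr ?mem_revstack //= eqxx addn0.
  by rewrite !(perm_size (perm_revstack _)).
have sL x : x \in L -> index x L < size L by rewrite index_mem.
have sTL x : x \in L -> index x (revstack L) < size L.
  by move=> xL; rewrite -(perm_size (perm_revstack UL)) index_mem mem_revstack.
have sTR x : x \in R -> index x (revstack R) < size R.
  by move=> xR; rewrite -(perm_size (perm_revstack UR)) index_mem mem_revstack.
have split x : x \in L ++ m :: R -> [\/ x \in L, x = m | x \in R].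
  rewrite mem_cat inE => /or3P[||]; first by constructor 1.
    by move/eqP; constructor 2.
  by constructor 3.
have wL x : x \in L -> x \in L ++ m :: R by rewrite mem_cat => ->.
have wm : m \in L ++ m :: R by rewrite mem_cat mem_head orbT.
have wR x : x \in R -> x \in L ++ m :: R.
  by move=> xR; rewrite mem_cat inE xR !orbT.
rewrite /before in IHL IHR *.
move=> /split[aL | am | aR] /split[bL | bm | bR].
- rewrite !jL // ltn_add2l IHL //; split=> -[c [cw ltbc]].
    by move=> ac cb; exists c; rewrite !iL // wL.
  case/split: (cw) => [cL | cm | cR]; rewrite ?cm ?im (iL a) // (iL b) //.
  + by rewrite iL //; exists c.
  + by move=> _; rewrite ltnNge ltnW ?sL.
  + by rewrite iR //; move: (sL b bL); clear; lia.
- rewrite bm jm jL //; split=> [|[c [/split c_w]]].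
    by move: (sTL a aL); clear; lia.
  rewrite ltnNge.
  by case: c_w => [/ltLm/ltnW-> | -> | /ltRm/ltnW->]; rewrite ?leqnn.
- rewrite jR // jL //; split=> [_ | _]; last first.
    by move: (sTR b bR); clear; lia.
  exists m; rewrite wm im iL // iR // ltRm // sL //; split=> //.
  by rewrite ltnS leq_addr.
- by move: ltab (ltLm b bL); rewrite am; clear; lia.
- by move: ltab; rewrite am bm ltnn.
- by move: ltab (ltRm b bR); rewrite am; clear; lia.
- rewrite (jR a) // (jL b) //; split=> [|[c [_ _]]].
    by move: (sTR a aR); clear; lia.
  by rewrite (iL b) // (iR a) //; move: (sL b bL); clear; lia.
- rewrite bm jm jR //; split=> [|[c [/split c_w]]].
    by move: (sTR a aR); clear; lia.
  rewrite ltnNge.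
  by case: c_w => [/ltLm/ltnW-> | -> | /ltRm/ltnW->]; rewrite ?leqnn.
- rewrite !jR // IHR //; split=> -[c [cw ltbc]].
    by move=> ac cb; exists c; rewrite !iR // wR // !ltnS !ltn_add2l.
  case/split: (cw) => [cL | cm | cR]; rewrite ?cm ?im (iR a) // (iR b) //.
  + by rewrite (iL c) //; move: (sL c cL); clear; lia.
  + by clear; lia.
  + by rewrite iR // !ltnS !ltn_add2l; exists c.
Qed.

Lemma sorted_ltn_no_inversion w :
  uniq w ->
  sorted ltn w <-> forall a b, a < b -> ~~ subseq [:: b; a] w.
Proof.
move=> Uw; split=> [sw a b ltab | no_inv].
  apply/negP => /(subseq_sorted ltn_trans)/(_ sw) /=; lia.
rewrite (sorted_pairwise ltn_trans); apply/(pairwiseP 0) => i j ltiw ltjw ltij.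
rewrite /= ltnNge leq_eqVlt nth_uniq // (gtn_eqF ltij) /=.
apply/negP => /no_inv/negP[].
by rewrite subseq_before //= /before !index_uniq // !mem_nth ?ltij.
Qed.

Lemma revstack_sorted w :
  uniq w ->
  sorted ltn (revstack w) <->
  forall a b c, a < b < c -> ~~ subseq [:: a; c; b] w.
Proof.
move=> Uw; rewrite sorted_ltn_no_inversion ?revstack_uniq //; split.
  move=> no_inv a b c /andP[ltab ltbc]; apply/negP => acb.
  have /and4P[aw cw bw _] : all (mem w) [:: a; c; b].
    by move: acb; rewrite subseq_before // => /andP[].
  have /negP[] := no_inv a b ltab.
  by apply/(revstack_inversion Uw aw bw ltab); exists c.
move=> no132 a b ltab; apply/negP => ba.
have := ba; rewrite subseq_before ?revstack_uniq //= !mem_revstack //.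
move=> /andP[/and3P[bw aw _] _].
have [c ltbc] := (revstack_inversion Uw aw bw ltab).1 ba.
by apply/negP; apply: no132; rewrite ltab.
Qed.

(** In the pattern [a; c; b] of the sorted word, [c; b] is an inversion while
    [a; c] is not, so both conditions translate back to [w] through
    [revstack_inversion]. *)
Lemma revstack_132 w a b c :
  uniq w -> a < b < c ->
  subseq [:: a; c; b] (revstack w) <->
  [/\ a \in w, exists2 d, c < d & subseq [:: b; d; c] w
    & forall e, c < e -> ~~ subseq [:: a; e; c] w].
Proof.
move=> Uw; have UT := revstack_uniq Uw.
move=> /andP[ltab ltbc]; have ltac := ltn_trans ltab ltbc.
have cb := @revstack_inversion w b c Uw; have ca := @revstack_inversion w a c Uw.
rewrite subseq_before //= !mem_revstack // !andbT.
split=> [/andP[/and3P[aw cw bw] /andP[bac bcb]] | [aw [d ltcd bdc] noe]].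
  split=> //.
    by apply/cb => //; rewrite subseq_before //= !mem_revstack // bw cw bcb.
  move=> e ltce; apply/negP => aec.
  have: subseq [:: c; a] (revstack w) by apply/ca => //; exists e.
  rewrite subseq_before //= => /andP[_]; move: bac; rewrite /before andbT; clear; lia.
have: all (mem w) [:: b; d; c] by move: bdc; rewrite subseq_before // => /andP[].
move=> /= /and4P[bw _ cw _].
have: subseq [:: c; b] (revstack w) by apply/cb => //; exists d.
rewrite subseq_before //= !mem_revstack // => /andP[_ /andP[-> _]].
rewrite aw bw cw /= andbT.
have: ~~ subseq [:: c; a] (revstack w).
  by apply/negP => /ca[]// e /noe/negP.
rewrite subseq_before //= !mem_revstack // aw cw /= andbT /before -leqNgt.
rewrite leq_eqVlt => /orP[/eqP eq_ac|//].
have eq_a_c : a = c.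
  by have := congr1 (nth 0 (revstack w)) eq_ac; rewrite !nth_index ?mem_revstack.
by rewrite eq_a_c ltnn in ltac.
Qed.

(** By [revstack_132] an obstruction is a quadruple a < b < c < d with b, d, c
    in this order in [w] and no letter above c after a and before c.  The letter a
    cannot precede d, since otherwise d itself would lie between a and c.  If a
    follows c the word b d c a is a 2431 pattern, and conversely such a pattern
    is an obstruction because no letter is both after a and before c.  If a lies between d and c the word b d a c is a 2413
    pattern with no letter above c between a and c, in particular none
    above d. *)
Lemma revstack2_sorted w :
  uniq w ->
  sorted ltn (revstack (revstack w)) <->
  (forall a b c d, a < b -> b < c -> c < d -> ~~ subseq [:: b; d; c; a] w) /\
  (forall a b c d, a < b -> b < c -> c < d -> subseq [:: b; d; a; c] w ->
     exists2 e, d < e & subseq [:: a; e; c] w).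
Proof.
move=> Uw; have UT := revstack_uniq Uw.
rewrite revstack_sorted //.
have step := revstack_132 Uw.
split=> [no132 | [no2431 bar] a b c /andP[ltab ltbc]].
  split=> a b c d ltab ltbc ltcd.
    have /step stepc : a < b < c by lia.
    have := no132 a b c; rewrite ltab ltbc => /(_ isT); apply: contra => bdca.
    apply/stepc; move: (bdca); rewrite subseq_before //= /before.
    move=> /andP[/and5P[bw dw cw aw _] ord]; split=> //.
      by exists d; rewrite ?subseq_before //= /before ?bw ?dw ?cw //; lia.
    move=> e _; rewrite subseq_before //= /before; lia.
  move=> bdac; move: (bdac); rewrite subseq_before //= /before.
  move=> /andP[/and5P[bw dw aw cw _] ord].
  (* Letters strictly between c and d may lie between a and c, so c is replaced
     by the largest letter x after a and up to c.  Either x exceeds d, or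
     b d a x is a 2413 pattern with nothing above x between a and x. *)
  pose Q x := [&& x \in w, index a w < index x w & index x w <= index c w].
  have Qc : exists x, Q x by exists c; rewrite /Q cw; lia.
  have leQ x : Q x -> x <= max_entry w.
    by case/and3P=> xw _ _; apply: (@leq_bigmax_seq _ w xpredT id).
  case: (ex_maxnP Qc leQ) => x /and3P[xw ax xc] maxx.
  have lecx : c <= x by apply: maxx; rewrite /Q cw; lia.
  have neq_xd : x != d by apply: contraTneq ax => ->; lia.
  case: (ltnP d x) => [ltdx | lexd].
    exists x => //; rewrite subseq_before //= /before aw xw cw ax /= andbT.
    rewrite ltn_neqAle xc andbT; apply/eqP => eq_xc.
    suff: x = c by lia.
    by have := congr1 (nth 0 w) eq_xc; rewrite !nth_index.
  have stepx : a < b < x by rewrite ltab (leq_trans ltbc lecx).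
  have /negP[] := no132 a b x stepx; apply/(step _ _ _ stepx); split=> //.
    exists d; first by rewrite ltn_neqAle neq_xd.
    by rewrite subseq_before //= /before bw dw xw; lia.
  move=> e ltxe; apply/negP; rewrite subseq_before //= /before.
  move=> /andP[/and4P[_ ew _ _] ord'].
  have := maxx e; rewrite /Q ew; lia.
apply/negP => /step[|aw [d ltcd bdc] noe]; first by rewrite ltab.
move: (bdc); rewrite subseq_before //= /before.
move=> /andP[/and4P[bw dw cw _] ord].
have neq_index x y : x \in w -> y \in w -> x <> y -> index x w <> index y w.
  by move=> xw yw neq /(congr1 (nth 0 w)); rewrite !nth_index.
have nac : index a w <> index c w by apply: neq_index => //; lia.
have nad : index a w <> index d w by apply: neq_index => //; lia.
have [ltac | leca] := ltnP (index a w) (index c w); last first.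
  have /negP[] := no2431 a b c d ltab ltbc ltcd.
  by rewrite subseq_before //= /before bw dw cw aw; lia.
have [ltda | lead] := ltnP (index d w) (index a w).
  have [|e ltde aec] := bar a b c d ltab ltbc ltcd.
    by rewrite subseq_before //= /before bw dw cw aw; lia.
  by have /negP := noe e (ltn_trans ltcd ltde).
have /negP[] := noe d ltcd.
by rewrite subseq_before //= /before dw cw aw; lia.
Qed.

(** * Pattern occurrences *)

Lemma order_isoP s t :
  reflect (size s = size t /\
           forall i j, i < size s -> j < size s ->
             (nth 0 s i < nth 0 s j) = (nth 0 t i < nth 0 t j))
          (order_iso s t).
Proof.
apply: (iffP andP) => [[/eqP-> /forallP ord] | [-> ord]]; split=> //.
  move=> i j lti ltj.
  by have /forallP/(_ (Ordinal ltj))/eqP := ord (Ordinal lti).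
by apply/forallP => i; apply/forallP => j; apply/eqP/ord.
Qed.

Lemma mem_occurrences s tau w :
  (s \in occurrences tau w) = subseq s w && order_iso s tau.
Proof. by rewrite mem_filter mem_subwords andbC. Qed.

Lemma order_iso_2431 s :
  reflect (exists a b c d, [/\ s = [:: b; d; c; a], a < b, b < c & c < d])
          (order_iso s [:: 2; 4; 3; 1]).
Proof.
apply: (iffP (order_isoP _ _)) => [[] | [a [b [c [d [-> ltab ltbc ltcd]]]]]].
  case: s => [|b [|d [|c [|a [|]]]]] //= _ ord; exists a, b, c, d.
  by split=> //; [have := ord 3 0 | have := ord 0 2 | have := ord 2 1];
     rewrite /= => ->.
by split=> // -[|[|[|[|i]]]] [|[|[|[|j]]]] //= _ _; lia.
Qed.

Lemma order_iso_2413 s :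
  reflect (exists a b c d, [/\ s = [:: b; d; a; c], a < b, b < c & c < d])
          (order_iso s [:: 2; 4; 1; 3]).
Proof.
apply: (iffP (order_isoP _ _)) => [[] | [a [b [c [d [-> ltab ltbc ltcd]]]]]].
  case: s => [|b [|d [|a [|c [|]]]]] //= _ ord; exists a, b, c, d.
  by split=> //; [have := ord 2 0 | have := ord 0 3 | have := ord 3 1];
     rewrite /= => ->.
by split=> // -[|[|[|[|i]]]] [|[|[|[|j]]]] //= _ _; lia.
Qed.

Lemma order_iso_24153 s :
  reflect (exists a b c d e,
             [/\ s = [:: b; d; a; e; c], a < b, b < c, c < d & d < e])
          (order_iso s [:: 2; 4; 1; 5; 3]).
Proof.
apply: (iffP (order_isoP _ _))
  => [[] | [a [b [c [d [e [-> ltab ltbc ltcd ltde]]]]]]].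
  case: s => [|b [|d [|a [|e [|c [|]]]]]] //= _ ord; exists a, b, c, d, e.
  by split=> //; [have := ord 2 0 | have := ord 0 4 | have := ord 4 1
                 | have := ord 1 3]; rewrite /= => ->.
by split=> // -[|[|[|[|[|i]]]]] [|[|[|[|[|j]]]]] //= _ _; lia.
Qed.

Lemma avoids_2431P w :
  avoids [:: 2; 4; 3; 1] w <->
  forall a b c d, a < b -> b < c -> c < d -> ~~ subseq [:: b; d; c; a] w.
Proof.
rewrite /avoids /contains negbK; split=> [/eqP occ0 a b c d ltab ltbc ltcd | no].
  apply/negP => sub; suff: [:: b; d; c; a] \in occurrences [:: 2; 4; 3; 1] w.
    by rewrite occ0.
  by rewrite mem_occurrences sub; apply/order_iso_2431; exists a, b, c, d.
case E: (occurrences _ _) => [//|s l].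
have: s \in occurrences [:: 2; 4; 3; 1] w by rewrite E mem_head.
rewrite mem_occurrences => /andP[sub /order_iso_2431[a [b [c [d [sE]]]]]].
by move=> ab bc cd; have := no a b c d ab bc cd; rewrite -sE sub.
Qed.

(** Inside an occurrence of 24153, an occurrence of 2413 can only arise by
    deleting the letter that plays 5, so the remaining letters keep their
    roles. *)
Lemma subseq_24153 a b c d a' b' c' d' e' :
  a < b -> b < c -> c < d -> a' < b' -> b' < c' -> c' < d' -> d' < e' ->
  subseq [:: b; d; a; c] [:: b'; d'; a'; e'; c'] ->
  [/\ a = a', b = b', c = c' & d = d'].
Proof.
move=> ab bc cd ab' bc' cd' de' /subseqP[m].
case: m => [|[] [|[] [|[] [|[] [|[] [|? m]]]]]] //= _ [*]; split; lia.
Qed.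

Lemma avoids_241b53P w :
  uniq w ->
  avoids_241b53 w <->
  forall a b c d, a < b -> b < c -> c < d -> subseq [:: b; d; a; c] w ->
    exists2 e, d < e & subseq [:: a; e; c] w.
Proof.
move=> Uw; split=> [/allP bar a b c d ab bc cd sub | bar].
  have /bar/hasP[s' ] : [:: b; d; a; c] \in occurrences [:: 2; 4; 1; 3] w.
    by rewrite mem_occurrences sub; apply/order_iso_2413; exists a, b, c, d.
  rewrite mem_occurrences => /andP[sub' /order_iso_24153].
  move=> [a' [b' [c' [d' [e [s'E ab' bc' cd' de']]]]]]; rewrite {}s'E in sub' *.
  case/subseq_24153=> // -> _ -> ->; exists e => //.
  apply: subseq_trans sub'; exact: (@suffix_subseq _ [:: b'; d']).
apply/allP => s; rewrite mem_occurrences => /andP[sub /order_iso_2413].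
move=> [a [b [c [d [sE ab bc cd]]]]]; rewrite {}sE in sub *.
have [e de aec] := bar a b c d ab bc cd sub.
apply/hasP; exists [:: b; d; a; e; c]; last first.
  by apply/subseqP; exists [:: true; true; true; false; true].
rewrite mem_occurrences; apply/andP; split; last first.
  by apply/order_iso_24153; exists a, b, c, d, e.
move: sub aec; rewrite !subseq_before //= /before.
move=> /andP[/and5P[-> -> -> -> _] ?] /andP[/and4P[_ -> _ _] ?] /=; lia.
Qed.

Lemma perm_word_perm n (p : {perm 'I_n}) : perm_eq (perm_word p) (iota 1 n).
Proof.
rewrite /perm_word -[in iota 1 n](addn0 1) iotaDl -val_enum_ord -map_comp.
rewrite (eq_map (g := (fun i : 'I_n => i.+1) \o p)) // map_comp.
apply: perm_map; apply: uniq_perm; rewrite ?(map_inj_uniq perm_inj) ?enum_uniq //.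
move=> i; rewrite mem_enum; apply/mapP; exists (p^-1%g i); rewrite ?mem_enum //.
by rewrite permKV.
Qed.

Theorem theorem2p12 (n : nat) (hn : 1 <= n) :
  [set p : {perm 'I_n} | revstack (revstack (perm_word p)) == iota 1 n] =
  [set p : {perm 'I_n} | avoids [:: 2; 4; 3; 1] (perm_word p) &
                         avoids_241b53 (perm_word p)].
Proof.
apply/setP => p; rewrite !inE; set w := perm_word p.
have w_iota : perm_eq w (iota 1 n) := perm_word_perm p.
have Uw : uniq w by rewrite (perm_uniq w_iota) iota_uniq.
have -> : (revstack (revstack w) == iota 1 n)
          = sorted ltn (revstack (revstack w)).
  apply/eqP/idP => [-> | sT]; first exact: iota_ltn_sorted.
  apply: (irr_sorted_eq ltn_trans ltnn sT (iota_ltn_sorted 1 n)) => x.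
  by rewrite !mem_revstack ?revstack_uniq // (perm_mem w_iota).
apply/idP/andP => [/(revstack2_sorted Uw)[no2431 bar] | [no2431 bar]].
  by split; [apply/avoids_2431P | apply/avoids_241b53P].
apply/(revstack2_sorted Uw).
by split; [apply/avoids_2431P | apply/avoids_241b53P].
Qed.
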